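(* Let $N\subset M$ be a finite index inclusion of type $\mathrm{II}_1$ factors, let $P,Q$ be intermediate subfactors, both different from $N$, and let $\{\lambda_i\}$ (resp. $\{\mu_j\}$) be a Pimsner–Popa basis for $P/N$ (resp. $Q/N$). Put $p:=\sum_{i,j}\lambda_i\mu_je_1\mu_j^*\lambda_i^*$ and $q:=\sum_{i,j}\mu_j\lambda_ie_1\lambda_i^*\mu_j^*$. Then the following are equivalent: (1) $(N,P,Q,M)$ is a commuting square, that is, $\alpha^N_M(P,Q)=\pi/2$; (2) $p=\bigvee\{ve_Qv^*: v\in\mathcal{U}(P)\}$; (3) $q=\bigvee\{ue_Pu^*: u\in\mathcal{U}(Q)\}$.
   Context: $E^M_A$ denotes the trace-preserving conditional expectation of $M$ onto $A\subseteq M$; $(N,P,Q,M)$ is a commuting square if $E^M_PE^M_Q=E^M_QE^M_P=E^M_N$. $M_1=\langle M,e_1\rangle$ is the Jones basic construction of $N\subset M$ on $L^2(M)$, $e_1$ being the orthogonal projection of $L^2(M)$ onto $L^2(N)$, and $tr$ is the normalized trace of $M_1$. For an intermediate subfactor $P$, $e_P\in N'\cap M_1$ is the orthogonal projection of $L^2(M)$ onto $L^2(P)$. For $P\neq N$ put $v_P=\frac{e_P-e_1}{\|e_P-e_1\|_2}$, where $\langle x,y\rangle=tr(y^*x)$ and $\|x\|_2=tr(x^*x)^{1/2}$. For $P,Q\ne N$ the angle is $\alpha^N_M(P,Q)=\cos^{-1}\langle v_P,v_Q\rangle$. $\mathcal{U}(P)$ is the unitary group of $P$, and $\bigvee$ is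 the supremum of projections on $L^2(M)$. A Pimsner–Popa basis (right basis, not necessarily orthonormal) for a finite index subfactor $A\subset B$, called a basis for $B/A$, is a finite set $\{\lambda_i\}\subset B$ such that $x=\sum_i\lambda_iE^B_A(\lambda_i^*x)$ for all $x\in B$. The operators $p,q$ do not depend on the chosen bases. *)

(* Defs.v *)
From mathcomp Require Import all_boot all_order all_algebra.
From mathcomp Require Import sesquilinear complex.
From mathcomp Require Import all_classical all_reals all_analysis.
Set Implicit Arguments.
Unset Strict Implicit.
Unset Printing Implicit Defensive.
Import Order.TTheory GRing.Theory Num.Theory.
Import numFieldNormedType.Exports.
Local Open Scope classical_set_scope.
Local Open Scope ring_scope.

(* Operators are plain functions H -> H, with their pointwise vector space
   structure, composition \o as product and idfun as unit; boundedness is a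
   predicate. *)

Section Operators.
Context {R : realType} {H : completeNormedModType R[i]}.
Variable ip : {dot H for Num.conj}. (* linear in the first argument *)

(* With H complete, this says that (H, ip) is a Hilbert space. *)
Definition norm_from_ip := forall x : H, ip x x = `|x| ^+ 2.

Definition bounded_op : set (H -> H) :=
  [set a | linear a /\ continuous a].

(* The adjoint exists and is unique for bounded a, by Riesz representation;
   the default 0 is only reached outside bounded operators. *)
Definition adj (a : H -> H) : H -> H :=
  xget 0 [set b | bounded_op b /\ forall x y, ip (a x) y = ip x (b y)].

Definition positive_op (a : H -> H) := forall x, 0 <= ip (a x) x.

Definition commutant (S : set (H -> H)) : set (H -> H) :=
  [set a | bounded_op a /\ forall b, S b -> a \o b = b \o a].

(* A'' = A makes A a weakly closed algebra containing the identity of H; all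
   inclusions below are therefore unital. *)
Definition von_neumann (A : set (H -> H)) :=
  [/\ A `<=` bounded_op,
      forall a, A a -> A (adj a)
    & commutant (commutant A) = A].

Definition vn_factor (A : set (H -> H)) :=
  von_neumann A /\
  forall a, A a -> commutant A a -> exists c : R[i], a = c *: idfun.

Definition finite_dim (A : set (H -> H)) :=
  exists (n : nat) (b : 'I_n -> H -> H),
    forall a, A a -> exists c : 'I_n -> R[i], a = \sum_i c i *: b i.

(* Weak operator continuity at 0 on the unit ball of A; for a linear phi this
   is ultraweak continuity on the von Neumann algebra A. *)
Definition normal_functional (A : set (H -> H)) (phi : (H -> H) -> R[i]) :=
  forall eps : R[i], 0 < eps ->
  exists (s : seq (H * H)) (delta : R[i]), 0 < delta /\
    forall a, A a -> (forall x, `|a x| <= `|x|) ->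
      (forall w, w \in s -> `|ip (a w.1) w.2| < delta) -> `|phi a| < eps.

(* Only the values of tr on A matter. On a II_1 factor there is exactly one
   such functional. *)
Definition normalized_trace (A : set (H -> H)) (tr : (H -> H) -> R[i]) :=
  [/\ forall (c : R[i]) a b, A a -> A b -> tr (c *: a + b) = c * tr a + tr b,
      tr idfun = 1,
      forall a b, A a -> A b -> tr (a \o b) = tr (b \o a),
      forall a, A a ->
        0 <= tr (adj a \o a) /\ (tr (adj a \o a) = 0 -> a = 0)
    & normal_functional A tr].

Definition II1_factor (A : set (H -> H)) :=
  [/\ vn_factor A, ~ finite_dim A & exists tr, normalized_trace A tr].

(* For a II_1 factor M, (H, Om) is L^2(M) with its left action of M: the
   vector state of Om is the trace of M, and x |-> x Om is the embedding of M
   into L^2(M), with dense range. Every II_1 factor is of this form, by the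
   GNS construction of its trace. *)
Definition is_L2 (M : set (H -> H)) (Om : H) :=
  [/\ `|Om| = 1,
      forall a b, M a -> M b -> ip ((a \o b) Om) Om = ip ((b \o a) Om) Om
    & closure [set a Om | a in M] = setT].

(* On H = L^2(M) this is finiteness of [M : N] = dim_N L^2(M): the coupling
   constant is infinite, by definition, when the commutant N' is an infinite
   factor, and is a finite number when N' is finite. *)
Definition finite_index (N : set (H -> H)) :=
  forall v, commutant N v -> adj v \o v = idfun -> v \o adj v = idfun.

(* The orthogonal projection onto a closed subspace K. *)
Definition orth_proj (K : set H) : H -> H := fun x =>
  xget 0 [set y | K y /\ forall z, K z -> ip (x - y) z = 0].

Definition jones_proj (Om : H) (A : set (H -> H)) : H -> H :=
  orth_proj (closure [set a Om | a in A]).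

Definition basic_construction (Om : H) (N M : set (H -> H)) : set (H -> H) :=
  commutant (commutant (M `|` [set jones_proj Om N])).

(* E is the conditional expectation of B onto A preserving the trace
   x |-> ip (x Om) Om; only its values on B matter. *)
Definition cond_exp (Om : H) (B A : set (H -> H))
    (E : (H -> H) -> (H -> H)) :=
  (forall x, B x -> A (E x)) /\
  [/\ forall (c : R[i]) x y, B x -> B y -> E (c *: x + y) = c *: E x + E y,
      forall x, B x -> positive_op x -> positive_op (E x),
      forall a, A a -> E a = a,
      forall a b x, A a -> A b -> B x ->
        E (a \o x \o b) = a \o E x \o b
    & forall x, B x -> ip (E x Om) Om = ip (x Om) Om].

Definition commuting_square (M : set (H -> H))
    (EP EQ EN : (H -> H) -> (H -> H)) :=
  forall x, M x -> EP (EQ x) = EN x /\ EQ (EP x) = EN x.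

(* lambda is a Pimsner-Popa basis for B/A, E being the expectation of B onto
   A. *)
Definition pp_basis (B : set (H -> H)) (E : (H -> H) -> (H -> H))
    (m : nat) (lambda : 'I_m -> H -> H) :=
  (forall i, B (lambda i)) /\
  forall x, B x -> x = \sum_i (lambda i \o E (adj (lambda i) \o x)).

Definition unitaries (A : set (H -> H)) : set (H -> H) :=
  [set u | [/\ A u, adj u \o u = idfun & u \o adj u = idfun]].

Definition projection (e : H -> H) :=
  [/\ bounded_op e, e \o e = e & adj e = e].

Definition proj_le (e f : H -> H) := range e `<=` range f.

(* The least upper bound in the lattice of projections, which is complete. *)
Definition proj_sup (S : set (H -> H)) : H -> H :=
  xget 0 [set f | [/\ projection f,
    forall e, S e -> proj_le e f
  & forall g, projection g -> (forall e, S e -> proj_le e g) ->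
      proj_le f g]].

Definition tr_norm (tr : (H -> H) -> R[i]) (x : H -> H) : R[i] :=
  sqrtC (tr (adj x \o x)).

Definition angle_vec (tr : (H -> H) -> R[i]) (Om : H)
    (N P : set (H -> H)) : H -> H :=
  let d := jones_proj Om P - jones_proj Om N in (tr_norm tr d)^-1 *: d.

(* <x, y> = tr (y^* x); its value here is a real number, whence the real
   part. *)
Definition angle (tr : (H -> H) -> R[i]) (Om : H)
    (N P Q : set (H -> H)) : R :=
  acos (complex.Re (tr (adj (angle_vec tr Om N Q) \o angle_vec tr Om N P))).

Definition pq_op (Om : H) (N : set (H -> H)) (m n : nat)
    (lambda : 'I_m -> H -> H) (mu : 'I_n -> H -> H) : H -> H :=
  \sum_i \sum_j (lambda i \o mu j \o jones_proj Om N
                   \o adj (mu j) \o adj (lambda i)).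

End Operators.

(* Main.v *)
(* Everything is expressed through the projections e_N, e_P, e_Q: the expectation
   E_A acts on x Om as e_A, and Om separates M, so the commuting square condition
   is e_Q e_P = e_N. Applying the basis property to E_P(x) Om gives
   e_P = sum_i lambda_i e_N lambda_i^*, whence e_P, e_Q lie in M_1 and
   p = sum_i lambda_i e_Q lambda_i^*.

   With z = e_Q e_P - e_N, <v_P, v_Q> is a positive multiple of
   tr z = tr (z^* z), which vanishes iff z = 0.

   If e_Q e_P = e_N, then E_Q = E_N on P and e_Q x e_Q = E_N(x) e_Q for x in P, so
   p v e_Q = v e_Q for v in P; hence p is a projection above all v e_Q v^*, and it
   is the least one because closed subspaces stable under the unitaries of P are
   stable under P. Conversely, if p is the supremum then p Om = Om, so
   sum_i |e_Q lambda_i^* Om|^2 = 1 = <e_P Om, Om> = sum_i |e_N lambda_i^* Om|^2;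
   as e_N <= e_Q, this forces E_Q(lambda_i) = E_N(lambda_i) for all i, and then
   E_Q = E_N on P. *)

Require Import Defs.
From HB Require Import structures.
From mathcomp Require Import all_boot all_order all_algebra.
From mathcomp Require Import sesquilinear complex.
From mathcomp Require Import all_classical all_reals all_analysis.
From mathcomp Require Import ring.
Set Implicit Arguments.
Unset Strict Implicit.
Unset Printing Implicit Defensive.
Import Order.TTheory GRing.Theory Num.Theory.
Import numFieldNormedType.Exports.
Local Open Scope classical_set_scope.
Local Open Scope ring_scope.

(** * Bounded operators *)

(** Outside [-1, 1] [acos] takes its default value 0, which differs from pi / 2; so the cosine of
    the angle never has to be located in [-1, 1]. *)
Lemma acos_eq_pihalf (R : realType) (r : R) : acos r = pi / 2 -> r = 0.
Proof.
rewrite acos.unlock; case: xgetP => [t _ [_ <-] ->|_ p0]; first exact: cos_pihalf.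
have := pi_gt0 R; rewrite -(pmulr_lgt0 _ (_ : 0 < 2^-1)) ?invr_gt0// -p0.
by rewrite ltxx.
Qed.

Section BoundedOperators.
Context {R : realType} {H : completeNormedModType R[i]}.
Implicit Types (a b : H -> H) (c : R[i]) (x y : H).

Lemma opZE c a x : (c *: a) x = c *: a x.
Proof. by []. Qed.

Lemma opDE a b x : (a + b) x = a x + b x.
Proof. by []. Qed.

Lemma opNE a x : (- a) x = - a x.
Proof. by []. Qed.

Lemma linD a : linear a -> forall x y, a (x + y) = a x + a y.
Proof. by move=> la x y; have := la 1 x y; rewrite !scale1r. Qed.

Lemma lin0 a : linear a -> a 0 = 0.
Proof. by move=> la; apply: (@addrI _ (a 0)); rewrite -linD// addr0 addr0. Qed.

Lemma linZ a : linear a -> forall c x, a (c *: x) = c *: a x.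
Proof. by move=> la c x; have := la c x 0; rewrite (lin0 la) !addr0. Qed.

Lemma linN a : linear a -> forall x, a (- x) = - a x.
Proof. by move=> la x; rewrite -scaleN1r linZ// scaleN1r. Qed.

Lemma linB a : linear a -> forall x y, a (x - y) = a x - a y.
Proof. by move=> la x y; rewrite linD// linN. Qed.

Lemma lin_sum a (la : linear a) (m : nat) (f : 'I_m -> H) :
  a (\sum_i f i) = \sum_i a (f i).
Proof.
by elim/big_rec2: _ => [|i y1 y2 _ <-]; rewrite ?lin0 ?linD.
Qed.

Lemma bounded_id : bounded_op (idfun : H -> H).
Proof. by split=> [//|x]; exact: cvg_id. Qed.

Lemma bounded_comp a b : bounded_op a -> bounded_op b -> bounded_op (a \o b).
Proof.
move=> [la ca] [lb cb]; split=> [c x y|x /=]; first by rewrite /= lb la.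
exact: (continuous_comp (cb x) (ca (b x))).
Qed.

Lemma bounded_addZ c a b :
  bounded_op a -> bounded_op b -> bounded_op (c *: a + b).
Proof.
move=> [la ca] [lb cb]; split=> [d x y|x].
  rewrite !fctE la lb !scalerDr !scalerA [c * d]mulrC -!addrA.
  by congr (_ + _); rewrite addrCA.
have -> : c *: a + b = (fun z => c *: a z + b z) by [].
by apply: cvgD; [apply: cvgZl_tmp; exact: ca|exact: cb].
Qed.

Lemma bounded_0 : bounded_op (0 : H -> H).
Proof.
have := bounded_addZ (-1) bounded_id bounded_id.
by rewrite scaleN1r addNr.
Qed.

Lemma bounded_sum (m : nat) (f : 'I_m -> H -> H) :
  (forall i, bounded_op (f i)) -> bounded_op (\sum_i f i).
Proof.
move=> bf; elim/big_ind: _ => [|a b ba bb|//]; first exact: bounded_0.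
by rewrite -[a]scale1r; exact: bounded_addZ.
Qed.

Lemma bounded_of_le a C :
  linear a -> (forall x, `|a x| <= C * `|x|) -> bounded_op a.
Proof.
move=> la aC; split=> // x; apply/cvgrPdist_lt => e e0.
have C0 : 0 < `|C| + 1 by rewrite ltr_wpDl.
near=> z; rewrite -linB//; apply: (le_lt_trans (aC _)).
have [->|xz] := eqVneq (x - z) 0; first by rewrite normr0 mulr0.
(* [C] is a complex number; the bound at the nonzero vector [x - z] makes it nonnegative, hence
   real. *)
have Cr : C \is Num.real.
  have := le_trans (normr_ge0 _) (aC (x - z)).
  by rewrite pmulr_lge0 ?normr_gt0// => /ger0_real.
apply: (@le_lt_trans _ _ ((`|C| + 1) * `|x - z|)).
  rewrite ler_wpM2r//; apply: (le_trans (real_ler_norm Cr)).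
  by rewrite lerDl.
rewrite -ltr_pdivlMl//; near: z; apply: cvgr_dist_lt; last by rewrite mulrC divr_gt0.
exact: cvg_id.
Unshelve. all: by end_near. Qed.

Lemma bounded_le a : bounded_op a ->
  exists C : R[i], 0 < C /\ forall x, `|a x| <= C * `|x|.
Proof.
move=> [la /(_ 0) ca].
pose L : {linear H -> H} := HB.pack a (GRing.isLinear.Build _ _ _ _ a la).
have /linear_boundedP /pinfty_ex_gt0[C C0 hC] : bounded_near L (nbhs 0).
  exact: continuous_linear_bounded.
by exists C.
Qed.

Lemma geometric_lt (C e : R[i]) : 0 <= C -> 0 < e -> exists m, C / 2 ^+ m < e.
Proof.
move=> C0 e0; exists (Num.bound (complex.Re C / complex.Re e)).
set m := Num.bound _.
have := upper_nthrootP (leqnn m); rewrite -/m.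
have e0' : 0 < complex.Re e by move: e0; rewrite ltcE => /andP[].
rewrite ltr_pdivrMr// mulrC -ltcR rmorphM/= rmorphXn/= rmorph_nat.
rewrite (RRe_real (ger0_real C0)) (RRe_real (gtr0_real e0)).
by rewrite ltr_pdivrMr ?exprn_gt0// mulrC.
Qed.

Lemma cvg_geometric (u : nat -> H) (C : R[i]) :
  (forall m n, (m <= n)%N -> `|u n - u m| <= C / 2 ^+ m) ->
  exists l, forall m, `|l - u m| <= C / 2 ^+ m.
Proof.
move=> uC.
have C0 : 0 <= C.
  by have := le_trans (normr_ge0 _) (uC 0 0 (leqnn _)); rewrite expr0 divr1.
have /cauchy_cvgP cu : cauchy (u @ \oo).
  apply: cauchy_exP => e /(geometric_lt C0)[m me]; exists (u m).
  exists m => // n /= mn; rewrite -ball_normE /= distrC.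
  exact: le_lt_trans (uC _ _ mn) me.
exists (lim (u @ \oo)) => m.
apply/ler_addgt0Pr => e e0.
have /cvgrPdist_lt /(_ _ e0) [N _ /(_ (maxn N m) (leq_maxl _ _))/= lN] := cu.
apply: (le_trans (ler_distD (u (maxn N m)) _ _)); rewrite addrC.
by apply: lerD; [apply: uC; exact: leq_maxr|exact: ltW].
Qed.

Lemma closure_normP (K : set H) x :
  closure K x <-> forall e : R[i], 0 < e -> exists y, K y /\ `|x - y| < e.
Proof.
split=> [Kx e e0|Kx B /nbhs_ballP[e /= e0 eB]].
  have [|y [Ky]] := Kx (ball x e); first exact: nbhsx_ballx.
  by rewrite -ball_normE /= => xye; exists y.
have [y [Ky xye]] := Kx e e0; exists y; split => //.
by apply: eB; rewrite -ball_normE.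
Qed.

End BoundedOperators.

(** * Adjoints and projections in a Hilbert space *)

Section InnerProduct.
Context {R : realType} {H : completeNormedModType R[i]}.
Variable ip : {dot H for Num.conj}.
Hypothesis ip_norm : norm_from_ip ip.
Implicit Types (a b : H -> H) (c : R[i]) (x y z w : H) (K : set H).

Lemma ipC x y : ip x y = Num.conj (ip y x).
Proof. by rewrite hermC /= expr0 mul1r. Qed.

Lemma ipDl x y z : ip (x + y) z = ip x z + ip y z.
Proof. exact: linearDl. Qed.

Lemma ipDr z x y : ip z (x + y) = ip z x + ip z y.
Proof. exact: linearDr. Qed.

Lemma ipZl c x z : ip (c *: x) z = c * ip x z.
Proof. exact: linearZl_LR. Qed.

Lemma ipZr z c x : ip z (c *: x) = Num.conj c * ip z x.
Proof. exact: linearZr_LR. Qed.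

Lemma ipBl x y z : ip (x - y) z = ip x z - ip y z.
Proof. exact: linearBl. Qed.

Lemma ipBr z x y : ip z (x - y) = ip z x - ip z y.
Proof. exact: linearBr. Qed.

Lemma ip0l z : ip 0 z = 0.
Proof. exact: linear0l. Qed.

Lemma ip0r z : ip z 0 = 0.
Proof. exact: linear0r. Qed.

Lemma ip_suml m (f : 'I_m -> H) z : ip (\sum_i f i) z = \sum_i ip (f i) z.
Proof. by elim/big_rec2: _ => [|i y1 y2 _ <-]; rewrite ?ip0l ?ipDl. Qed.

Lemma ip_sumr m (f : 'I_m -> H) z : ip z (\sum_i f i) = \sum_i ip z (f i).
Proof. by elim/big_rec2: _ => [|i y1 y2 _ <-]; rewrite ?ip0r ?ipDr. Qed.

Lemma ip_ge0 x : 0 <= ip x x.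
Proof. by rewrite ip_norm exprn_ge0. Qed.

Lemma ip_eq0 x : ip x x = 0 -> x = 0.
Proof. by rewrite ip_norm => /eqP; rewrite sqrf_eq0 normr_eq0 => /eqP. Qed.

Lemma ip_ext x y : (forall z, ip x z = ip y z) -> x = y.
Proof.
by move=> xy; apply/eqP; rewrite -subr_eq0; apply/eqP/ip_eq0; rewrite ipBl xy subrr.
Qed.

Lemma pythagoras x y : ip x y = 0 -> ip (x + y) (x + y) = ip x x + ip y y.
Proof.
by move=> xy; rewrite ipDl !ipDr (ipC y x) xy rmorph0 addr0 add0r.
Qed.

Lemma cauchy_schwarz x y : `|ip x y| <= `|x| * `|y|.
Proof.
have [->|y0] := eqVneq y 0; first by rewrite ip0r !normr0 mulr0.
have yy0 : 0 < ip y y by rewrite ip_norm exprn_gt0// normr_gt0.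
pose c := ip x y / ip y y.
(* [c *: y] is the component of [x] along [y]; dropping the orthogonal remainder in Pythagoras gives
   the inequality. *)
have o : ip (x - c *: y) (c *: y) = 0.
  by rewrite ipZr ipBl ipZl divfK ?gt_eqF// subrr mulr0.
have := pythagoras o; rewrite subrK => E.
rewrite -(@ler_pXn2r _ 2) ?nnegrE ?mulr_ge0// exprMn -!ip_norm.
rewrite -ler_pdivrMr// E -[leLHS]add0r lerD ?ip_ge0//.
rewrite ipZl ipZr mulrA -normCK normrM exprMn normfV (gtr0_norm yy0).
by rewrite [(ip y y)^-1 ^+ 2]expr2 -!mulrA mulVf ?mulr1// gt_eqF.
Qed.

Lemma orth_closure K w z :
  (forall y, K y -> ip w y = 0) -> closure K z -> ip w z = 0.
Proof.
move=> wK /closure_normP Kz; apply/eqP; rewrite -normr_le0.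
apply/ler_addgt0Pr => e e0; rewrite add0r.
have w0 : 0 < `|w| + 1 by rewrite ltr_wpDl.
have [|y [Ky zy]] := Kz (e / (`|w| + 1)); first by rewrite divr_gt0.
rewrite -[ip w z]subr0 -(wK _ Ky) -ipBr; apply: (le_trans (cauchy_schwarz _ _)).
move: zy; rewrite ltr_pdivlMr// => /ltW; apply: le_trans.
by rewrite mulrC ler_wpM2l// lerDl.
Qed.

Definition adjoint a b := forall x y, ip (a x) y = ip x (b y).

Lemma adjointC a b : adjoint a b -> adjoint b a.
Proof. by move=> ab x y; rewrite ipC -ab -ipC. Qed.

Lemma adjP a b : bounded_op b -> adjoint a b -> adj ip a = b.
Proof.
move=> bb ab; apply: xget_unique => // b' [_ ab']; apply/funext => y.
by apply: ip_ext => z; rewrite ipC -ab' ab -ipC.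
Qed.

Lemma adjoint_comp a a' b b' :
  adjoint a a' -> adjoint b b' -> adjoint (a \o b) (b' \o a').
Proof. by move=> aa bb x y; rewrite /= aa bb. Qed.

Lemma adjoint_addZ c a a' b b' : adjoint a a' -> adjoint b b' ->
  adjoint (c *: a + b) (Num.conj c *: a' + b').
Proof.
by move=> aa bb x y; rewrite !fctE ipDl ipDr ipZl ipZr conjCK aa bb.
Qed.

Lemma adjointB a a' b b' :
  adjoint a a' -> adjoint b b' -> adjoint (a - b) (a' - b').
Proof. by move=> aa bb x y; rewrite !opDE !opNE ipBl ipBr aa bb. Qed.

(** * Orthogonal projections onto subspaces *)

Definition subspace K := K 0 /\ forall c x y, K x -> K y -> K (c *: x + y).

Lemma subspaceB K x y : subspace K -> K x -> K y -> K (x - y).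
Proof. by move=> [_ Kl] Kx Ky; rewrite addrC -scaleN1r; exact: Kl. Qed.

Lemma subspaceZ K c x : subspace K -> K x -> K (c *: x).
Proof. by move=> [K0 Kl] Kx; rewrite -[_ *: x]addr0; exact: Kl. Qed.

Lemma subspace_sum K m (f : 'I_m -> H) :
  subspace K -> (forall i, K (f i)) -> K (\sum_i f i).
Proof.
move=> [K0 Kl] Kf; elim/big_ind: _ => [//|x y Kx Ky|//].
by rewrite -[x]scale1r; exact: Kl.
Qed.

Lemma subspace_closure K : subspace K -> subspace (closure K).
Proof.
move=> [K0 Kl]; split; first exact: subset_closure.
move=> c x y /closure_normP Kx /closure_normP Ky; apply/closure_normP => e e0.
have c0 : 0 < `|c| + 1 by rewrite ltr_wpDl.
have e20 : 0 < e / 2 by rewrite divr_gt0.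
have [|x' [Kx' xx]] := Kx (e / 2 / (`|c| + 1)); first by rewrite divr_gt0.
have [y' [Ky' yy]] := Ky _ e20.
exists (c *: x' + y'); split; first exact: Kl.
rewrite opprD addrACA -scalerBr [ltRHS]splitr.
apply: (le_lt_trans (ler_normD _ _)); apply: ler_ltD => //.
rewrite normrZ; move: xx; rewrite ltr_pdivlMr// mulrC => /ltW.
by apply: le_trans; rewrite ler_wpM2r// lerDl.
Qed.

(** A pointwise description with no operator property built in: for a subspace [K], linearity,
    self-adjointness and contractivity are derived from it. *)
Definition projects K a := forall x, K (a x) /\ forall z, K z -> ip (x - a x) z = 0.

Section Projects.
Variables (K : set H) (e : H -> H).
Hypotheses (Ks : subspace K) (eK : projects K e).

Lemma projects_uniq x y : K y -> (forall z, K z -> ip (x - y) z = 0) -> e x = y.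
Proof.
move=> Ky xy; have [Kex xe] := eK x.
apply/eqP; rewrite -subr_eq0; apply/eqP/ip_eq0.
have Kd := subspaceB Ks Kex Ky.
have -> : ip (e x - y) (e x - y) = ip (x - y) (e x - y) - ip (x - e x) (e x - y).
  by rewrite -ipBl opprB [X in _ = ip X _]addrC addrA subrK.
by rewrite xy// xe// subrr.
Qed.

Lemma projects_fix x : K x -> e x = x.
Proof. by move=> Kx; apply: projects_uniq => // z _; rewrite subrr ip0l. Qed.

Lemma projects_idem : e \o e = e.
Proof. by apply/funext => x /=; apply: projects_fix; exact: (eK x).1. Qed.

Lemma projects_linear : linear e.
Proof.
move=> c x y; have [Kx xe] := eK x; have [Ky ye] := eK y.
apply: projects_uniq; first exact: Ks.2.
move=> z Kz; rewrite opprD addrACA -scalerBr ipDl ipZl xe// ye//.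
by rewrite mulr0 addr0.
Qed.

Lemma projects_adjoint : adjoint e e.
Proof.
move=> x y; have [Kx xe] := eK x; have [Ky ye] := eK y.
have := xe _ Ky; rewrite ipBl => /eqP; rewrite subr_eq0 => /eqP ->.
have := ye _ Kx; rewrite ipBl => /eqP; rewrite subr_eq0 => /eqP E.
by rewrite ipC E -ipC.
Qed.

Lemma projects_pythagoras x : ip x x = ip (e x) (e x) + ip (x - e x) (x - e x).
Proof.
have [Kx xe] := eK x.
have {1 2}-> : x = (x - e x) + e x by rewrite subrK.
by rewrite (pythagoras (xe _ Kx)) addrC.
Qed.

Lemma projects_le x : `|e x| <= `|x|.
Proof.
rewrite -(@ler_pXn2r _ 2) ?nnegrE// -!ip_norm (projects_pythagoras x).
by rewrite lerDl ip_ge0.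
Qed.

Lemma projects_bounded : bounded_op e.
Proof.
apply: (@bounded_of_le _ _ _ 1); first exact: projects_linear.
by move=> x; rewrite mul1r projects_le.
Qed.

End Projects.

Lemma projects_sub K K' a b : K `<=` K' -> subspace K -> subspace K' ->
  projects K a -> projects K' b -> a \o b = a /\ b \o a = a.
Proof.
move=> KK' Ks Ks' aK bK'; split; apply/funext => x /=; last first.
  by apply: (projects_fix Ks' bK'); apply: KK'; exact: (aK x).1.
apply/esym/(projects_uniq Ks aK); first exact: (aK _).1.
move=> z Kz; have -> : x - a (b x) = (x - b x) + (b x - a (b x)) by rewrite subrKA.
by rewrite ipDl (bK' x).2 ?(aK _).2 ?addr0//; exact: KK'.
Qed.

(** The equation [adj e = e] could also come from the default value of [adj]; then [e] is 0, which
    is self-adjoint anyway. *)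
Lemma projection_adjoint e : projection ip e -> adjoint e e.
Proof.
move=> [_ _]; rewrite /adj; case: xgetP => [b bE [_ ab]|_].
  by move=> eb x y; rewrite ab eb.
by move=> <- x y; rewrite ip0l ip0r.
Qed.

Lemma projection_range_fix e x : projection ip e -> range e x -> e x = x.
Proof. by move=> [_ ee _] [y _ <-]; have /= := congr1 (@^~ y) ee. Qed.

Lemma proj_le_antisym e f : projection ip e -> projection ip f ->
  proj_le e f -> proj_le f e -> e = f.
Proof.
move=> pe pf ef fe; apply/funext => x; apply: ip_ext => y.
have ef' : e y = f (e y).
  by apply/esym/projection_range_fix => //; apply: ef; exists y.
have fe' : f x = e (f x).
  by apply/esym/projection_range_fix => //; apply: fe; exists x.
rewrite (projection_adjoint pe) ef' -(projection_adjoint pf).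
by rewrite -(projection_adjoint pe) -fe'.
Qed.

Lemma proj_sup_eq (S : set (H -> H)) f : projection ip f ->
  (forall e, S e -> proj_le e f) ->
  (forall g, projection ip g -> (forall e, S e -> proj_le e g) -> proj_le f g) ->
  proj_sup ip S = f.
Proof.
move=> pf Sf fS; apply: xget_unique => // g [pg Sg gS].
by apply: proj_le_antisym => //; [exact: gS|exact: fS].
Qed.

(** The fixed points are the range of [g]; their closedness allows limit arguments inside an
    arbitrary upper bound of a family of projections. *)
Lemma projection_fixed_closed g : projection ip g ->
  subspace [set x | g x = x] /\ closed [set x | g x = x].
Proof.
move=> [[lg cg] gg _]; split.
  by split=> [|c x y /= gx gy]; [exact: lin0|rewrite /= lg gx gy].
have gb : bounded_op g by [].
have [C [C0 gC]] := bounded_le gb.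
move=> x /closure_normP gx; apply/eqP; rewrite -subr_eq0 -normr_le0.
apply/ler_addgt0Pr => e e0; rewrite add0r.
have [|y [/= gy xy]] := gx (e / (C + 1)); first by rewrite divr_gt0// addr_gt0.
have -> : g x - x = g (x - y) - (x - y) by rewrite linB// gy opprB addrA subrK.
apply: (le_trans (ler_normB _ _)).
apply: (@le_trans _ _ ((C + 1) * `|x - y|)).
  by rewrite mulrDl mul1r lerD2r.
by rewrite mulrC -ler_pdivlMr ?addr_gt0// ltW.
Qed.

(** The projections of a sequence in [D] tending to [x] form a Cauchy sequence, because projecting
    contracts distances, and their limit is the projection of [x]. On L^2(M) the dense set will be M
    Om, where the projection is explicit. *)
Lemma orth_projP K (D : set H) : subspace K -> closed K -> closure D = setT ->
  (forall x, D x -> exists y, K y /\ forall z, K z -> ip (x - y) z = 0) ->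
  projects K (orth_proj ip K).
Proof.
move=> Ks Kc Dd Dp x; rewrite /orth_proj; apply: (@xgetPex _ 0
  [set y | K y /\ forall z, K z -> ip (x - y) z = 0]) => /=.
have p2 m : 0 < 1 / 2 ^+ m :> R[i] by rewrite divr_gt0// exprn_gt0.
have /choice[f fP] : forall m, exists d : H * H, [/\ `|x - d.1| < 1 / 2 ^+ m,
    K d.2 & forall z, K z -> ip (d.1 - d.2) z = 0].
  move=> m; have : closure D x by rewrite Dd.
  move=> /closure_normP /(_ _ (p2 m))[d [Dd' xd]].
  by have [y [Ky dy]] := Dp _ Dd'; exists (d, y).
have mono m n : (m <= n)%N -> 1 / 2 ^+ n <= 1 / 2 ^+ m :> R[i].
  move=> mn; rewrite !div1r lef_pV2 ?posrE ?exprn_gt0//.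
  by rewrite ler_weXn2l// ler1n.
have [y yP] : exists l, forall m, `|l - (f m).2| <= 2 / 2 ^+ m.
  apply: cvg_geometric => m n mn.
  have [fn1 fn2 fn3] := fP n; have [fm1 fm2 fm3] := fP m.
  have Kd := subspaceB Ks fn2 fm2.
  apply: (@le_trans _ _ `|(f n).1 - (f m).1|).
    set u := _ - (f m).2 in Kd *; set v := (f n).1 - _.
    (* [v] splits orthogonally as [u] plus [v - u], so passing from two points to their projections
       does not increase the distance. *)
    have o : ip (v - u) u = 0.
      have -> : v - u = ((f n).1 - (f n).2) - ((f m).1 - (f m).2).
        by rewrite /v /u !opprB addrACA [RHS]addrACA; congr (_ + _); rewrite addrC.
      by rewrite ipBl fn3// fm3// subrr.
    rewrite -(@ler_pXn2r _ 2) ?nnegrE// -!ip_norm.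
    have -> : ip v v = ip (v - u) (v - u) + ip u u by rewrite -pythagoras// subrK.
    by rewrite lerDr ip_ge0.
  apply: (le_trans (ler_distD x _ _)).
  have -> : 2 / 2 ^+ m = 1 / 2 ^+ m + 1 / 2 ^+ m :> R[i] by rewrite -mulrDl.
  apply: lerD; last exact: ltW.
  by rewrite distrC; apply: (le_trans (ltW fn1)); exact: mono.
exists y; split.
  apply: Kc; apply/closure_normP => e e0.
  have [m me] := geometric_lt (ler0n _ 2) e0.
  exists (f m).2; split; first by have [] := fP m.
  exact: le_lt_trans (yP m) me.
move=> z Kz; apply/eqP; rewrite -normr_le0.
apply/ler_addgt0Pr => e e0; rewrite add0r.
(* The 3 collects 1 from the distance of [x] to [(f m).1] and 2 from that of [(f m).2] to [y]; the
   remaining piece is orthogonal to [K]. *)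
have [|m me] := @geometric_lt _ (3 * `|z|) _ _ e0; first by rewrite mulr_ge0.
have [fm1 fm2 fm3] := fP m.
apply/ltW/(le_lt_trans _ me).
have -> : x - y = (x - (f m).1) + ((f m).2 - y) + ((f m).1 - (f m).2).
  by rewrite [RHS]addrAC !subrKA.
rewrite ipDl fm3// addr0; apply: (le_trans (cauchy_schwarz _ _)).
rewrite mulrAC ler_wpM2r//; apply: (le_trans (ler_normD _ _)).
rewrite -[3]/(1 + 2)%:R natrD mulrDl lerD//; first exact: ltW.
by rewrite distrC.
Qed.

End InnerProduct.

(** * Unitaries of a von Neumann algebra *)

Section OperatorAlgebras.
Context {R : realType} {H : completeNormedModType R[i]}.
Variable ip : {dot H for Num.conj}.
Hypothesis ip_norm : norm_from_ip ip.
Implicit Types (a b s u : H -> H) (c : R[i]) (x y z w : H) (A S : set (H -> H)).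

Definition unital_algebra A :=
  [/\ A `<=` bounded_op, A idfun, forall a b, A a -> A b -> A (a \o b)
    & forall c a b, A a -> A b -> A (c *: a + b)].

Lemma bicommutant_algebra S : unital_algebra (commutant (commutant S)).
Proof.
split=> [a []//||a b [ba ca] [bb cb]|c a b [ba ca] [bb cb]].
- by split; first exact: bounded_id.
- split; first exact: bounded_comp.
  by move=> d Sd; rewrite -compA cb// compA ca.
- split; first exact: bounded_addZ.
  move=> d Sd; have [[ld _] _] := Sd; apply/funext => x.
  rewrite /= !fctE ld; congr (_ *: _ + _).
    by have /= -> := congr1 (@^~ x) (ca _ Sd).
  by have /= -> := congr1 (@^~ x) (cb _ Sd).
Qed.

Lemma bicommutant_sub S : S `<=` bounded_op -> S `<=` commutant (commutant S).
Proof. by move=> bS a Sa; split=> [|b [_ Sb]]; [exact: bS|rewrite Sb]. Qed.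

Lemma von_neumann_algebra A : von_neumann ip A -> unital_algebra A.
Proof. by move=> [_ _ <-]; exact: bicommutant_algebra. Qed.

Section Algebra.
Variables (A : set (H -> H)) (algA : unital_algebra A).

Lemma algebra_0 : A 0.
Proof.
have [_ A1 _ Al] := algA; have := Al (-1) _ _ A1 A1.
by rewrite scaleN1r addNr.
Qed.

Lemma algebraZ c a : A a -> A (c *: a).
Proof.
by move=> Aa; rewrite -[_ *: _]addr0; have [_ _ _] := algA; apply=> //; exact: algebra_0.
Qed.

Lemma algebraD a b : A a -> A b -> A (a + b).
Proof. by move=> Aa Ab; rewrite -[a]scale1r; have [_ _ _] := algA; apply. Qed.

Lemma algebraB a b : A a -> A b -> A (a - b).
Proof.
by move=> Aa Ab; rewrite addrC -scaleN1r; have [_ _ _] := algA; apply.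
Qed.

Lemma algebra_sum m (f : 'I_m -> H -> H) : (forall i, A (f i)) -> A (\sum_i f i).
Proof.
by move=> Af; elim/big_ind: _ => // [|a b]; [exact: algebra_0|exact: algebraD].
Qed.

Lemma algebra_orbit_subspace x : subspace [set a x | a in A].
Proof.
have [_ _ _ Al] := algA; split; first by exists 0 => //; exact: algebra_0.
by move=> c _ _ [a Aa <-] [b Ab <-]; exists (c *: a + b); first exact: Al.
Qed.

Section Trace.
Variable tr : (H -> H) -> R[i].
Hypothesis trA : normalized_trace ip A tr.

Lemma trace0 : tr 0 = 0.
Proof.
have [trl _ _ _ _] := trA; have := trl 1 _ _ algebra_0 algebra_0.
rewrite scale1r mul1r addr0 => tr00.
by apply: (@addrI _ (tr 0)); rewrite addr0 -tr00.
Qed.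

Lemma traceZ c a : A a -> tr (c *: a) = c * tr a.
Proof.
move=> Aa; have [trl _ _ _ _] := trA.
by rewrite -[_ *: _]addr0 trl ?trace0 ?addr0//; exact: algebra_0.
Qed.

Lemma traceB a b : A a -> A b -> tr (a - b) = tr a - tr b.
Proof.
move=> Aa Ab; have [trl _ _ _ _] := trA.
by rewrite addrC -scaleN1r trl// mulN1r addrC.
Qed.

(* [adj a] has the junk value [0] when [a] has no adjoint; faithfulness of the
   trace excludes this without an appeal to the Riesz representation. *)
Lemma trace_adjoint a : A a -> bounded_op (adj ip a) /\ adjoint ip a (adj ip a).
Proof.
move=> Aa; have [_ _ _ trp _] := trA.
rewrite /adj; case: xgetP => [b _ //|noadj].
have a0 : a = 0.
  by apply: (trp _ Aa).2; rewrite [adj _ _]xgetPN//; exact: trace0.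
exfalso; apply: (noadj 0); split; first exact: bounded_0.
by move=> x y; rewrite a0 ip0l ip0r.
Qed.

End Trace.

End Algebra.

Lemma neumann_series s : bounded_op s -> (forall x, `|s x| <= `|x| / 2) ->
  exists r, [/\ bounded_op r, forall x, r x - s (r x) = x,
    forall x, r (x - s x) = x & forall x, `|r x| <= 2 * `|x|].
Proof.
move=> [ls cs] s2.
(* This lower bound for 1 - s yields both the left inverse law and the norm bound of the inverse
   [r]. *)
have inj x : `|x| <= 2 * `|x - s x|.
  have := ler_normD (x - s x) (s x); rewrite subrK => /le_trans.
  move=> /(_ _ (lerD (lexx _) (s2 x))); rewrite -lerBlDr.
  have -> : `|x| - `|x| / 2 = `|x| / 2 by rewrite {1}[`|x|]splitr addrK.
  by rewrite ler_pdivrMr// mulrC.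
have /choice[r rP] : forall y, exists x, x - s x = y.
  (* The iterates of x |-> y + s x are the partial sums of the Neumann series at [y]; their limit is
     the fixed point. *)
  move=> y; pose v n := iter n (fun x => y + s x) 0.
  have v0 k : `|v k| <= 2 * `|y|.
    elim: k => [|k IHk]; first by rewrite normr0 mulr_ge0.
    rewrite /= mulr_natl mulr2n; apply: (le_trans (ler_normD _ _)).
    rewrite lerD2l; apply: (le_trans (s2 _)).
    by rewrite ler_pdivrMr// mulrC.
  have [l lP] : exists l, forall m, `|l - v m| <= 2 * `|y| / 2 ^+ m.
    apply: cvg_geometric => m n mn; rewrite -(subnKC mn); move: (n - m)%N => k.
    elim: m {mn} => [|m IHm]; first by rewrite subr0 expr0 divr1 v0.
    rewrite addSn /= opprD addrACA subrr add0r -linB//.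
    apply: (le_trans (s2 _)); rewrite exprSr invfM mulrA.
    by rewrite ler_wpM2r// invr_ge0.
  exists l; apply/eqP; rewrite -subr_eq0 -normr_le0.
  apply/ler_addgt0Pr => e e0; rewrite add0r.
  have C0 : 0 <= 2 * (2 * `|y|) by rewrite !mulr_ge0.
  have [m me] := geometric_lt C0 e0; apply/ltW/(le_lt_trans _ me).
  have -> : l - s l - y = (l - v m.+1) + s (v m - l).
    by rewrite linB//= opprD [l + (- y - _)]addrA subrKA addrAC.
  have -> : 2 * (2 * `|y|) / 2 ^+ m = 2 * `|y| / 2 ^+ m + 2 * `|y| / 2 ^+ m.
    by rewrite -mulrDl -[X in _ = X / _]mulr2n -[X in _ = X / _]mulr_natl.
  apply: (le_trans (ler_normD _ _)).
  have h2 : `|v m - l| <= 2 * `|y| / 2 ^+ m by rewrite distrC.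
  apply: lerD.
    apply: (le_trans (lP _)); rewrite ler_wpM2l ?mulr_ge0// lef_pV2 ?posrE ?exprn_gt0//.
    by rewrite ler_weXn2l// ler1n.
  apply: (le_trans (s2 _)); apply: (le_trans _ h2).
  by rewrite ler_pdivrMr// ler_peMr// ler1n.
have rs x : r (x - s x) = x.
  apply/eqP; rewrite -subr_eq0 -normr_le0; apply: (le_trans (inj _)).
  by rewrite (linB ls) opprD addrACA -opprD rP subrr normr0 mulr0.
have rl : linear r.
  move=> c x y; rewrite -[RHS]rs; congr r.
  by rewrite ls opprD addrACA -scalerBr !rP.
have r2 x : `|r x| <= 2 * `|x| by rewrite -{2}[x]rP.
by exists r; split=> //; exact: bounded_of_le r2.
Qed.

(* The Cayley transform [(1 + s) (1 - s)^-1] is [1 + 2 s] to first order. *)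
Lemma cayley_unitary A s : von_neumann ip A -> A s -> adjoint ip s (- s) ->
  (forall x, `|s x| <= `|x| / 2) ->
  exists u, unitaries ip A u /\ forall C, 0 <= C ->
    (forall x, `|s x| <= C * `|x|) ->
    forall x, `|u x - x - 2 *: s x| <= 4 * C ^+ 2 * `|x|.
Proof.
move=> vA As ss s2; have algA := von_neumann_algebra vA.
have [Ab A1 Ac Al] := algA; have [_ _ bicA] := vA.
have sb := Ab _ As; have [ls _] := sb.
have sN x y : ip (s x) y = - ip x (s y) by rewrite ss -scaleN1r ipZr rmorphN1 mulN1r.
have bsN : bounded_op (- s) by apply: Ab; rewrite -scaleN1r; exact: algebraZ.
have [r [rb rP1 rP2 r2]] := neumann_series sb s2.
have [|r' [rb' rP1' rP2' r2']] := neumann_series bsN.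
  by move=> x; rewrite [(- s) x]/(- s x) normrN.
have {}rP1' x : r' x + s (r' x) = x by rewrite -[RHS]rP1' [(- s) _]/(- s _) opprK.
have {}rP2' x : r' (x + s x) = x by rewrite -[RHS]rP2' [(- s) _]/(- s _) opprK.
(* An operator commuting with s commutes with 1 - s, hence with its inverse [r]; so [r] lies in the
   bicommutant of [A], which is [A]. *)
have Ar : A r.
  rewrite -bicA; split=> // b Ab'; have [[lb _] bc] := Ab'; apply/funext => x /=.
  rewrite -{1}[x]rP1 linB//.
  have /= -> := congr1 (@^~ (r x)) (bc _ As).
  by rewrite rP2.
have Ar' : A r'.
  rewrite -bicA; split=> // b Ab'; have [[lb _] bc] := Ab'; apply/funext => x /=.
  rewrite -{1}[x]rP1' linD//.
  have /= -> := congr1 (@^~ (r' x)) (bc _ As).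
  by rewrite rP2'.
have r's x : r' (s x) = s (r' x).
  by rewrite -{1}[x]rP1' linD// rP2'.
(* [u] is (1 + s)(1 - s)^-1, and [u'] is (1 - s)(1 + s)^-1, which turns out to be both its adjoint
   and its inverse. *)
pose u := r + (s \o r); pose u' := r' - (s \o r').
have Au : A u by apply: algebraD => //; exact: Ac.
have Au' : A u' by apply: algebraB => //; exact: Ac.
have uE x : u x = r x + s (r x) by [].
have u'E x : u' x = r' x - s (r' x) by [].
have uu' : adjoint ip u u'.
  have rr x y : ip (r x) y = ip x (r' y).
    by rewrite -{1}[y]rP1' ipDr -[ip (r x) (s _)]opprK -sN -ipBl rP1.
  by move=> x y; rewrite uE u'E ipDl sN !rr ipBr r's.
have adju : adj ip u = u' by apply: adjP => //; exact: Ab.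
have lr' := (Ab _ Ar').1.
exists u; split.
  split=> //; rewrite adju; apply/funext => x /=.
    have us : u x - s (u x) = x + s x.
      by rewrite uE linD// opprD addrACA rP1 -linB// rP1.
    by rewrite u'E -r's -linB// us rP2'.
  by rewrite uE u'E rP2 rP1'.
(* Exactly, u - 1 - 2 s = 2 s^2 r, and [r] has norm at most 2, whence the 4. *)
move=> C C0 sC x; have -> : u x - x - 2 *: s x = 2 *: s (s (r x)).
  rewrite uE -{3 4}[x]rP1 (linB ls) opprB [X in X - _]addrC subrKA.
  by rewrite -mulr2n -scaler_nat scalerBr opprB addrC subrK.
rewrite normrZ normr_nat -[4]/(2 * 2)%:R natrM -!mulrA ler_wpM2l//.
apply: (le_trans (sC _)); rewrite mulrCA ler_wpM2l//.
by apply: (le_trans (sC _)); rewrite mulrCA ler_wpM2l.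
Qed.

(** The Cayley transforms u of small multiples t s give difference quotients (u x - x) / (2 t) in
    [K] that tend to [s x]. *)
Lemma skew_closed_span A K x s : von_neumann ip A -> subspace K -> closed K ->
  (forall u, unitaries ip A u -> K (u x)) ->
  A s -> adjoint ip s (- s) -> K (s x).
Proof.
move=> vA Ks Kc Ku As ss; have algA := von_neumann_algebra vA.
have [Ab A1 _ _] := algA.
have Kx : K x.
  apply: (Ku idfun); have ai : adj ip idfun = idfun.
    by apply: (adjP ip_norm) => //; exact: bounded_id.
  by split; rewrite ?ai.
apply: Kc; apply/closure_normP => e e0.
have [C [C0 sC]] := bounded_le (Ab _ As).
(* The term 2 C makes t C at most 1/2, as the Cayley transform requires; the other term makes the
   quadratic error at most t e, less than the allowed 2 t e. *)
pose D := 2 * C + 4 * C ^+ 2 * `|x| / e; pose t := D^-1.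
have C0' := ltW C0.
have D1 : 2 * C <= D by rewrite lerDl divr_ge0 ?(ltW e0)// !mulr_ge0.
have D0 : 0 < D by apply: lt_le_trans D1; rewrite mulr_gt0.
have t0 : 0 < t by rewrite invr_gt0.
have tC : t * C <= 1 / 2.
  by rewrite mulrC ler_pdivrMr// mulrAC mul1r ler_pdivlMr// mulrC.
have At : A (t *: s) by exact: algebraZ.
have tsC y : `|(t *: s) y| <= t * C * `|y|.
  by rewrite [(t *: s) y]/(t *: s y) normrZ (gtr0_norm t0) -mulrA ler_wpM2l// ltW.
have [|y|u [Uu /(_ _ _ tsC x) ux]] := cayley_unitary vA At.
- by move=> y z; rewrite opNE !opZE -scalerN ipZl ipZr ss opNE conj_Creal ?gtr0_real.
- by apply: (le_trans (tsC y)); rewrite [leRHS]mulrC -[2^-1]mul1r ler_wpM2r.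
exists ((2 * t)^-1 *: (u x - x)); split.
  by apply: subspaceZ => //; apply: subspaceB => //; exact: Ku.
have t20 : 0 < 2 * t by rewrite mulr_gt0.
have -> : s x - (2 * t)^-1 *: (u x - x) =
    - ((2 * t)^-1 *: (u x - x - 2 *: (t *: s) x)).
  rewrite -[RHS]scalerN opprB [RHS]scalerBr; congr (_ - _).
  by rewrite opZE !scalerA -mulrA mulVf ?scale1r// gt_eqF.
rewrite normrN normrZ gtr0_norm ?invr_gt0// mulrC ltr_pdivrMr//.
apply: (le_lt_trans (ux _)); first by rewrite mulr_ge0// ltW.
have tD : t * (4 * C ^+ 2 * `|x|) <= e.
  rewrite mulrC ler_pdivrMr// mulrDr [e * (_ / e)]mulrC divfK ?gt_eqF//.
  by rewrite lerDr !mulr_ge0 ?ltW.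
have -> : 4 * (t * C) ^+ 2 * `|x| = t * (t * (4 * C ^+ 2 * `|x|)) by ring.
apply: (@le_lt_trans _ _ (t * e)); first by rewrite ler_wpM2l// ltW.
by rewrite mulrC ltr_pM2l// mulr_natl mulr2n ltrDl.
Qed.

(** It is enough to reach skew-adjoint elements: with [b] the adjoint of [a], both [a - b] and
    [i *: (a + b)] are skew-adjoint, and [a] is a linear combination of them. *)
Lemma unitaries_closed_span A K x : von_neumann ip A ->
  (forall a, A a -> bounded_op (adj ip a) /\ adjoint ip a (adj ip a)) ->
  subspace K -> closed K ->
  (forall u, unitaries ip A u -> K (u x)) -> forall a, A a -> K (a x).
Proof.
move=> vA Aadj Ks Kc Ku a Aa; have algA := von_neumann_algebra vA.
have [_ aa] := Aadj _ Aa; have [_ Astar _] := vA; have Aa' := Astar _ Aa.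
set b := adj ip a in aa Aa' *.
pose i : R[i] := 'i.
have ci : Num.conj i = - i by exact: conjCi.
have K1 : K ((a - b) x).
  apply: (skew_closed_span vA Ks Kc Ku); first exact: algebraB.
  have := adjoint_addZ (-1) (adjointC aa) aa.
  by rewrite rmorphN1 !scaleN1r opprB [- b + a]addrC [- a + b]addrC.
have K2 : K ((i *: (a + b)) x).
  apply: (skew_closed_span vA Ks Kc Ku).
    by apply: algebraZ => //; exact: algebraD.
  have ab : adjoint ip (a + b) (a + b).
    have := adjoint_addZ 1 aa (adjointC aa).
    by rewrite rmorph1 !scale1r [b + a]addrC.
  move=> y z; rewrite opNE !opZE -scaleNr ipZl ipZr ab.
  by rewrite rmorphN /= ci opprK.
have -> : a x = 2^-1 *: ((a - b) x) + (- i / 2) *: ((i *: (a + b)) x).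
  rewrite opZE scalerA mulrAC mulNr -expr2 sqrCi opprK mul1r.
  rewrite -scalerDr !opDE opNE [a x + b x]addrC subrKA.
  by rewrite -[a x + _]mulr2n -[a x *+ 2]scaler_nat scalerA mulVf ?scale1r.
by apply: Ks.2 => //; exact: subspaceZ.
Qed.

End OperatorAlgebras.

(** * Jones projections on L^2(M) *)

Section StandardForm.
Context {R : realType} {H : completeNormedModType R[i]}.
Variable ip : {dot H for Num.conj}.
Hypothesis ip_norm : norm_from_ip ip.
Variables (M : set (H -> H)) (Om : H).
Hypotheses (vM : von_neumann ip M) (L2M : is_L2 ip M Om)
  (Madj : forall a, M a -> bounded_op (adj ip a) /\ adjoint ip a (adj ip a)).
Implicit Types (a b : H -> H) (x y : H -> H) (A B : set (H -> H)).
Local Notation star := (adj ip).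
Local Notation e_ := (jones_proj ip Om).
Local Notation L2 A := (closure [set a Om | a in A]).

Let algM : unital_algebra M := von_neumann_algebra vM.
Let Mb a : M a -> bounded_op a. Proof. by have [+ _ _ _] := algM; apply. Qed.
Let Ml a : M a -> linear a. Proof. by move=> /Mb[]. Qed.
Let Mc a b : M a -> M b -> M (a \o b).
Proof. by have [_ _ + _] := algM; apply. Qed.
Let Mstar a : M a -> M (star a). Proof. by have [_ + _] := vM; apply. Qed.
Let Ma a : M a -> adjoint ip a (star a). Proof. by move=> /Madj[]. Qed.

Lemma adj_involutive a : M a -> star (star a) = a.
Proof. by move=> Aa; apply: adjP => //; [exact: Mb|apply/adjointC/Ma]. Qed.

Lemma L2_dense_ext a b : bounded_op a -> bounded_op b ->
  (forall y, M y -> a (y Om) = b (y Om)) -> a = b.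
Proof.
move=> ba bb ab; have [_ _ dM] := L2M.
have bd : bounded_op (a - b).
  by rewrite addrC -scaleN1r; exact: bounded_addZ.
have [C [C0 dC]] := bounded_le bd.
apply/funext => z; apply/eqP; rewrite -subr_eq0 -normr_le0.
apply/ler_addgt0Pr => e e0; rewrite add0r.
have /closure_normP /(_ (e / C)) : L2 M z by rewrite dM.
case=> [|_ [[y My <-] zy]]; first by rewrite divr_gt0.
have -> : a z - b z = (a - b) (z - y Om).
  by rewrite opDE opNE (linB ba.1) (linB bb.1) ab// opprB addrA subrK.
by apply: (le_trans (dC _)); rewrite mulrC -ler_pdivlMr// ltW.
Qed.

(** The trace identity gives |a^* Om| = |a Om| = 0 and turns |a y Om|^2 into <a y y^* a^* Om, Om> =
    0, so [a] vanishes on the dense set M Om. *)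
Lemma L2_separating a : M a -> a Om = 0 -> a = 0.
Proof.
move=> Aa aO; have [_ trM _] := L2M.
have Aa' := Mstar Aa.
have aO' : star a Om = 0.
  apply: (ip_eq0 ip_norm); rewrite -(Ma Aa).
  have /= -> := trM _ _ Aa Aa'.
  by rewrite aO (lin0 (Ml Aa')) ip0l.
apply: L2_dense_ext => [||y My]; [exact: Mb|exact: bounded_0|].
apply: (ip_eq0 ip_norm); rewrite (Ma Aa) (Ma My) ipC.
have /= E := trM _ _ (Mc Aa My) (Mc (Mstar My) Aa').
by rewrite -E aO' (lin0 (Ml (Mstar My))) (lin0 (Ml My)) (lin0 (Ml Aa)) ip0l rmorph0.
Qed.

Lemma L2_ext a b : M a -> M b -> a Om = b Om -> a = b.
Proof.
move=> Aa Ab ab; apply/eqP; rewrite -subr_eq0; apply/eqP/L2_separating.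
  exact: algebraB.
by rewrite opDE opNE ab subrr.
Qed.

(** Trace preservation and the bimodule property: with tau the vector state of Om, tau(b^* x) =
    tau(E(b^* x)) = tau(b^* E(x)). *)
Lemma cexp_orth A B E : von_neumann ip A -> unital_algebra B -> A `<=` B -> B `<=` M ->
  cond_exp ip Om B A E -> forall x b, B x -> A b ->
  ip (x Om - E x Om) (b Om) = 0.
Proof.
move=> vA [_ B1 Bc _] AB BM [_ [_ _ _ Emod Etr]] x b Bx Ab.
have [_ Astar _] := vA; have [_ A1 _ _] := von_neumann_algebra vA.
have Mb' := Ma (BM _ (AB _ Ab)).
rewrite -(adjointC Mb') (linB (Ml (Mstar (BM _ (AB _ Ab))))) ipBl.
have := Etr (star b \o x \o idfun); rewrite Emod//; last exact: Astar.
move=> /= ->; first by rewrite subrr.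
by apply: (Bc (star b \o x)) => //; apply: Bc => //; apply: AB; exact: Astar.
Qed.

(** * Conditional expectations seen through Jones projections *)

Section Subalgebra.
Variables (A : set (H -> H)) (E : (H -> H) -> H -> H).
Hypotheses (vA : von_neumann ip A) (AM : A `<=` M) (cE : cond_exp ip Om M A E).
Let algA := von_neumann_algebra vA.

Lemma L2_subspace : subspace (L2 A).
Proof. by apply: subspace_closure; exact: algebra_orbit_subspace. Qed.

Lemma jones_projects : projects ip (L2 A) (e_ A).
Proof.
have [_ _ dM] := L2M.
apply: (orth_projP ip_norm L2_subspace (@closed_closure _ _) dM).
(* On the dense set M Om the projection is supplied by the expectation. *)
move=> _ [x Mx <-]; exists (E x Om); split.
  by apply: subset_closure; exists (E x) => //; exact: cE.1.
move=> z; apply: (orth_closure ip_norm) => _ [b Ab <-].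
exact: (cexp_orth vA algM AM).
Qed.

Lemma jones_bounded : bounded_op (e_ A).
Proof. exact: (projects_bounded ip_norm L2_subspace jones_projects). Qed.

Lemma jones_adjoint : adjoint ip (e_ A) (e_ A).
Proof. exact: (projects_adjoint jones_projects). Qed.

Lemma jones_idem : e_ A \o e_ A = e_ A.
Proof. exact: (projects_idem ip_norm L2_subspace jones_projects). Qed.

Lemma jones_fix a : A a -> e_ A (a Om) = a Om.
Proof.
move=> Aa; apply: (projects_fix ip_norm L2_subspace jones_projects).
by apply: subset_closure; exists a.
Qed.

(** Stated for any [B] between [A] and [M], so that it serves the expectations of M as well as those
    of P and Q onto N. *)
Lemma jones_cexp B EB x : unital_algebra B -> A `<=` B -> B `<=` M ->
  cond_exp ip Om B A EB -> B x -> e_ A (x Om) = EB x Om.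
Proof.
move=> algB AB BM cEB Bx.
apply: (projects_uniq ip_norm L2_subspace jones_projects).
  by apply: subset_closure; exists (EB x) => //; exact: cEB.1.
move=> z; apply: (orth_closure ip_norm) => _ [b Ab <-].
exact: (cexp_orth vA algB AB).
Qed.

Lemma jones_cexpM x : M x -> e_ A (x Om) = E x Om.
Proof. exact: jones_cexp. Qed.

Lemma cexp_restrict B EB x : unital_algebra B -> A `<=` B -> B `<=` M ->
  cond_exp ip Om B A EB -> B x -> EB x = E x.
Proof.
move=> algB AB BM cEB Bx; apply: L2_ext.
- by apply: AM; exact: cEB.1.
- by apply: AM; apply: cE.1; exact: BM.
- by rewrite -(jones_cexp algB AB BM)// jones_cexpM//; exact: BM.
Qed.

(** Traciality reduces the orthogonality of x^* Om - E(x)^* Om to b Om to that of x Om - E(x) Om to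
    b^* Om; so E(x)^* Om is the projection of x^* Om. *)
Lemma cexp_adj x : M x -> E (star x) = star (E x).
Proof.
move=> Mx; have [_ trM _] := L2M; have [_ Astar _] := vA.
have AE := cE.1 _ Mx; have ME := AM AE.
apply: L2_ext; [by apply: AM; apply: cE.1; exact: Mstar|exact: Mstar|].
rewrite -jones_cexpM; last exact: Mstar.
apply: (projects_uniq ip_norm L2_subspace jones_projects).
  by apply: subset_closure; exists (star (E x)) => //; exact: Astar.
move=> z; apply: (orth_closure ip_norm) => _ [b Ab <-].
have Mb' := AM Ab.
rewrite ipBl !(adjointC (Ma _))// ![ip Om _]ipC.
have /= -> := trM _ _ Mx Mb'; have /= -> := trM _ _ ME Mb'.
rewrite !(Ma Mb') -rmorphB -ipBl.
by rewrite (cexp_orth vA algM AM) ?rmorph0//; exact: Astar.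
Qed.

Lemma cexp_mulr x b : M x -> A b -> E (x \o b) = E x \o b.
Proof.
move=> Mx Ab; have [_ [_ _ _ Emod _]] := cE; have [_ A1 _ _] := algA.
exact: Emod idfun b x A1 Ab Mx.
Qed.

(** The Jones relation: at y Om both sides are E(x) E(y) Om, because E(x E(y)) = E(x) E(y). *)
Lemma jones_sandwich x z : M x -> e_ A (x (e_ A z)) = E x (e_ A z).
Proof.
move=> Mx; have AE := cE.1 _ Mx.
have bA := jones_bounded; have bx := Mb Mx; have bE := Mb (AM AE).
apply: (congr1 (@^~ z) (_ : e_ A \o (x \o e_ A) = E x \o e_ A)).
apply: L2_dense_ext => [||y My].
- by apply: bounded_comp => //; exact: bounded_comp.
- exact: bounded_comp.
rewrite /= jones_cexpM//; have Ay := cE.1 _ My.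
by have /= -> := jones_cexpM (Mc Mx (AM Ay)); rewrite cexp_mulr.
Qed.

End Subalgebra.

Lemma jones_sub A B EA EB : von_neumann ip A -> von_neumann ip B ->
  A `<=` B -> B `<=` M -> cond_exp ip Om M A EA -> cond_exp ip Om M B EB ->
  e_ A \o e_ B = e_ A /\ e_ B \o e_ A = e_ A.
Proof.
move=> vA vB AB BM cA cB; apply: (@projects_sub _ _ _ ip_norm (L2 A) (L2 B)).
- by apply: closureS => _ [a Aa <-]; exists a => //; exact: AB.
- exact: L2_subspace.
- exact: L2_subspace.
- by apply: (@jones_projects _ EA) => // a /AB/BM.
- exact: (@jones_projects _ EB).
Qed.

Lemma jones_basis (N P : set (H -> H)) EN EP EPN m (lambda : 'I_m -> H -> H) :
  von_neumann ip N -> von_neumann ip P -> N `<=` P -> P `<=` M ->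
  cond_exp ip Om M N EN -> cond_exp ip Om M P EP -> cond_exp ip Om P N EPN ->
  pp_basis ip P EPN lambda ->
  e_ P = \sum_i (lambda i \o e_ N \o star (lambda i)).
Proof.
move=> vN vP NP PM cN cP cPN [lP basis].
have NM : N `<=` M by move=> a /NP/PM.
have lM i : M (lambda i) by exact: PM.
have bN := jones_bounded vN NM cN.
apply: L2_dense_ext => [||y My]; first exact: (jones_bounded vP PM cP).
  apply: bounded_sum => i; apply: bounded_comp; last exact/Mb/Mstar.
  by apply: bounded_comp; first exact: Mb.
have [PE [_ _ _ Pmod _]] := cP; have [_ Pstar _] := vP.
have algP := von_neumann_algebra vP; have [_ P1 Pc _] := algP.
rewrite (jones_cexpM vP PM cP)// {1}(basis _ (PE _ My)) !fct_sumE.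
(* Termwise: [EPN] acts as e_N on P Om, lambda_i^* E_P(y) = E_P(lambda_i^* y), and e_N e_P = e_N. *)
apply: eq_bigr => i _ /=; congr (lambda i _).
rewrite -(jones_cexp vN NM cN algP NP PM cPN); last first.
  by apply: Pc; [exact: Pstar|exact: PE].
have [+ _] := jones_sub vN vP NP PM cN cP.
move=> /(congr1 (@^~ (star (lambda i) (y Om)))) /= <-; congr (e_ N _).
have -> := jones_cexpM vP PM cP (Mc (Mstar (lM i)) My).
by have /= <- := congr1 (@^~ Om) (Pmod _ idfun y (Pstar _ (lP i)) P1 My).
Qed.

Lemma commuting_square_jones (N P Q : set (H -> H)) EN EP EQ :
  von_neumann ip N -> von_neumann ip P -> von_neumann ip Q ->
  N `<=` P -> P `<=` M -> Q `<=` M ->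
  cond_exp ip Om M N EN -> cond_exp ip Om M P EP -> cond_exp ip Om M Q EQ ->
  commuting_square M EP EQ EN <-> e_ Q \o e_ P = e_ N.
Proof.
move=> vN vP vQ NP PM QM cN cP cQ.
have NM : N `<=` M by move=> a /NP/PM.
have bN := jones_bounded vN NM cN; have bP := jones_bounded vP PM cP.
have bQ := jones_bounded vQ QM cQ.
split=> [cs|QP].
  apply: L2_dense_ext => // [|y My]; first exact: bounded_comp.
  rewrite /= (jones_cexpM vP PM cP)// (jones_cexpM vN NM cN)//.
  rewrite (jones_cexpM vQ QM cQ); last by apply: PM; exact: cP.1.
  by have [_ ->] := cs _ My.
(* Taking adjoints gives the other order, so the one relation [e_ Q \o e_ P = e_ N] encodes both
   halves of the commuting square. *)
have PQ : e_ P \o e_ Q = e_ N.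
  apply/funext => z; apply: (ip_ext ip_norm) => w.
  rewrite /= (jones_adjoint vP PM cP) (jones_adjoint vQ QM cQ).
  by have /= -> := congr1 (@^~ w) QP; rewrite -(jones_adjoint vN NM cN).
move=> x Mx; have PE := PM _ (cP.1 _ Mx); have QE := QM _ (cQ.1 _ Mx).
have NE := NM _ (cN.1 _ Mx).
split; apply: L2_ext => //.
- by apply: PM; exact: cP.1.
- rewrite -(jones_cexpM vP PM cP)// -(jones_cexpM vQ QM cQ)// -(jones_cexpM vN NM cN)//.
  by have /= -> := congr1 (@^~ (x Om)) PQ.
- by apply: QM; exact: cQ.1.
- rewrite -(jones_cexpM vQ QM cQ)// -(jones_cexpM vP PM cP)// -(jones_cexpM vN NM cN)//.
  by have /= -> := congr1 (@^~ (x Om)) QP.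
Qed.

(** * Two intermediate algebras: the supremum and the angle *)

Section TwoSubfactors.
Variables (N P Q : set (H -> H)) (EN EP EQ EPN : (H -> H) -> H -> H).
Variables (m : nat) (lambda : 'I_m -> H -> H).
Hypotheses (vN : von_neumann ip N) (vP : von_neumann ip P) (vQ : von_neumann ip Q)
  (NP : N `<=` P) (NQ : N `<=` Q) (PM : P `<=` M) (QM : Q `<=` M)
  (cN : cond_exp ip Om M N EN) (cP : cond_exp ip Om M P EP)
  (cQ : cond_exp ip Om M Q EQ) (cPN : cond_exp ip Om P N EPN)
  (lambdaP : pp_basis ip P EPN lambda).

Let NM : N `<=` M. Proof. by move=> a /NP/PM. Qed.
Let algP : unital_algebra P := von_neumann_algebra vP.
Let Pc a b : P a -> P b -> P (a \o b).
Proof. by have [_ _ + _] := algP; apply. Qed.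
Let Pstar a : P a -> P (star a). Proof. by have [_ + _] := vP; apply. Qed.
Let lP i : P (lambda i). Proof. exact: lambdaP.1. Qed.
Let lM i : M (lambda i). Proof. exact: PM. Qed.

Let EPN_EN x : P x -> EPN x = EN x.
Proof. by move=> Px; apply: (cexp_restrict vN NM cN algP NP PM cPN). Qed.

(** For each i the inner sum is the basis expansion of e_Q, so [mu] drops out. *)
Lemma pq_opE n (mu : 'I_n -> H -> H) EQN : cond_exp ip Om Q N EQN ->
  pp_basis ip Q EQN mu ->
  pq_op ip Om N lambda mu = \sum_i (lambda i \o e_ Q \o star (lambda i)).
Proof.
move=> cQN muQ; apply: eq_bigr => i _; apply/funext => z.
rewrite (jones_basis vN vQ NQ QM cN cQ cQN muQ) !fct_sumE /=.
by rewrite (lin_sum (Ml (lM i))).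
Qed.

Let p := \sum_i (lambda i \o e_ Q \o star (lambda i)).

Let pE z : p z = \sum_i lambda i (e_ Q (star (lambda i) z)).
Proof. by rewrite /p fct_sumE. Qed.

Let p_bounded : bounded_op p.
Proof.
apply: bounded_sum => i; apply: bounded_comp; last exact/Mb/Mstar.
by apply: bounded_comp; [exact: Mb|exact: (jones_bounded vQ QM cQ)].
Qed.

Let p_adjoint : adjoint ip p p.
Proof.
move=> z w; rewrite !pE ip_suml ip_sumr; apply: eq_bigr => i _.
by rewrite (Ma (lM i)) (jones_adjoint vQ QM cQ) (adjointC (Ma (lM i))).
Qed.

Lemma commuting_sup : e_ Q \o e_ P = e_ N ->
  proj_sup ip [set v \o e_ Q \o star v | v in unitaries ip P] = p.
Proof.
move=> QP.
have EQN x : P x -> EQ x = EN x.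
  move=> Px; have Mx := PM Px; apply: L2_ext.
  - by apply: QM; exact: cQ.1.
  - by apply: NM; exact: cN.1.
  rewrite -(jones_cexpM vQ QM cQ)// -(jones_cexpM vN NM cN)// -QP /=.
  by rewrite (jones_fix vP PM cP).
(* As lambda_i^* v lies in P, between two copies of e_Q it becomes its expectation onto N; the basis
   property then reassembles v. *)
have pv v z : P v -> p (v (e_ Q z)) = v (e_ Q z).
  move=> Pv; rewrite pE [in RHS](lambdaP.2 _ Pv) fct_sumE.
  apply: eq_bigr => i _ /=; congr (lambda i _).
  have Pl : P (star (lambda i) \o v) by apply: Pc => //; exact: Pstar.
  have /= -> := jones_sandwich vQ QM cQ z (PM Pl).
  by rewrite EQN// -EPN_EN.
have Padj a : P a -> bounded_op (star a) /\ adjoint ip a (star a).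
  by move=> /PM /Madj.
apply: (proj_sup_eq ip_norm).
- split=> //; last exact: (adjP ip_norm).
  (* Idempotence: by [pv] with v = lambda_i, [p] fixes each summand of [p z]. *)
  apply/funext => z /=; rewrite !(pE z).
  rewrite (lin_sum p_bounded.1); apply: eq_bigr => i _.
  exact: pv.
- move=> _ [v [Pv _ _] <-] _ [z _ <-] /=.
  by exists (v (e_ Q (star v z))); [|exact: pv].
- move=> g pg Sg _ [z _ <-].
  have [gs gc] := projection_fixed_closed pg.
  exists (p z) => //; rewrite pE.
  apply: (subspace_sum gs) => i.
  (* It is enough that [g] fixes v e_Q lambda_i^* z for unitary v, and this vector is v e_Q v^*
     applied to v lambda_i^* z. *)
  apply: (unitaries_closed_span ip_norm vP Padj gs gc) => // v Uv.
  have [Pv vv _] := Uv; apply: (projection_range_fix pg).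
  apply: (Sg (v \o e_ Q \o star v)); first by exists v.
  exists (v (star (lambda i) z)) => //=.
  by have /= -> := congr1 (@^~ (star (lambda i) z)) vv.
Qed.

Lemma sup_commuting :
  p = proj_sup ip [set v \o e_ Q \o star v | v in unitaries ip P] ->
  e_ Q \o e_ P = e_ N.
Proof.
move=> psup; have [Om1 _ _] := L2M.
have algQ := von_neumann_algebra vQ.
have ipOm : ip Om Om = 1 by rewrite ip_norm Om1 expr1n.
have sumE A EA : von_neumann ip A -> A `<=` M -> cond_exp ip Om M A EA ->
    ip ((\sum_i (lambda i \o e_ A \o star (lambda i))) Om) Om =
    \sum_i ip (e_ A (star (lambda i) Om)) (e_ A (star (lambda i) Om)).
  move=> vA AM cA; rewrite fct_sumE ip_suml; apply: eq_bigr => i _ /=.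
  rewrite (Ma (lM i)) -(jones_adjoint vA AM cA).
  by have /= -> := congr1 (@^~ (star (lambda i) Om)) (jones_idem vA AM cA).
have sumN : \sum_i ip (e_ N (star (lambda i) Om)) (e_ N (star (lambda i) Om)) = 1.
  rewrite -(sumE _ _ vN NM cN) -(jones_basis vN vP NP PM cN cP cPN lambdaP).
  have [_ P1 _ _] := algP.
  by have /= -> := jones_fix vP PM cP P1.
have [eNQ _] := jones_sub vN vQ NQ QM cN cQ.
have split_N z : ip (e_ Q z) (e_ Q z) =
    ip (e_ N z) (e_ N z) + ip (e_ Q z - e_ N z) (e_ Q z - e_ N z).
  have := projects_pythagoras (jones_projects vN NM cN) (e_ Q z).
  by have /= -> := congr1 (@^~ z) eNQ.
have le_NQ z : ip (e_ N z) (e_ N z) <= ip (e_ Q z) (e_ Q z).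
  by rewrite (split_N z) lerDl ip_ge0.
have pOm : ip (p Om) Om = 1.
  (* This lower bound excludes the default value 0 of [proj_sup], so [p] is a genuine supremum in
     what follows. *)
  have : 1 <= ip (p Om) Om.
    by rewrite (sumE _ _ vQ QM cQ) -sumN; apply: ler_sum => i _.
  rewrite psup /proj_sup; case: xgetP => [f _ [pf Sf _] _|_]; last first.
    by rewrite ip0l ler10.
  (* The unitary v = 1 puts e_Q below [f], and e_Q fixes Om. *)
  have -> : f Om = Om.
    apply: (projection_range_fix pf); apply: (Sf (idfun \o e_ Q \o star idfun)).
      exists idfun => //; have ai : star idfun = idfun.
        by apply: (adjP ip_norm) => //; exact: bounded_id.
      by have [_ P1 _ _] := algP; split; rewrite ?ai.
    exists Om => //=; have -> : star idfun = idfun.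
      by apply: (adjP ip_norm) => //; exact: bounded_id.
    by have [_ Q1 _ _] := algQ; have /= -> := jones_fix vQ QM cQ Q1.
  exact: ipOm.
(* With y_i = lambda_i^* Om, the nonnegative differences |e_Q y_i|^2 - |e_N y_i|^2 sum to 1 - 1 = 0,
   so each vanishes; each is also |e_Q y_i - e_N y_i|^2. *)
have QNstar i : e_ Q (star (lambda i) Om) = e_ N (star (lambda i) Om).
  apply/eqP; rewrite -subr_eq0; apply/eqP/(ip_eq0 ip_norm).
  move: pOm; rewrite (sumE _ _ vQ QM cQ) -sumN => /eqP.
  rewrite -subr_eq0 -sumrB psumr_eq0 => [|j _]; last by rewrite subr_ge0.
  move=> /allP /(_ i (mem_index_enum _)) /= /eqP.
  by rewrite split_N addrC addKr.
(* The vectors above involve lambda_i^*; taking adjoints carries the equality of expectations over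
   to lambda_i. *)
have QNl i : EQ (lambda i) = EN (lambda i).
  have Ms := Mstar (lM i).
  rewrite -[lambda i]adj_involutive// (cexp_adj vQ QM cQ)// (cexp_adj vN NM cN)//.
  congr (star _); apply: L2_ext.
  - by apply: QM; exact: cQ.1.
  - by apply: NM; exact: cN.1.
  by rewrite -(jones_cexpM vQ QM cQ)// -(jones_cexpM vN NM cN).
apply: L2_dense_ext => [||y My].
- by apply: bounded_comp; [exact: (jones_bounded vQ QM cQ)|exact: (jones_bounded vP PM cP)].
- exact: (jones_bounded vN NM cN).
have [+ _] := jones_sub vN vP NP PM cN cP.
move=> /(congr1 (@^~ (y Om))) /= <-.
rewrite (jones_cexpM vP PM cP)//; have Px := cP.1 _ My; move: (EP y) Px => x Px.
(* With x = sum_i lambda_i b_i and b_i in N, right N-linearity extends the agreement of E_Q and E_N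
   from the basis to P. *)
rewrite [in LHS](lambdaP.2 _ Px) [in RHS](lambdaP.2 _ Px) fct_sumE.
rewrite (lin_sum (jones_bounded vQ QM cQ).1) (lin_sum (jones_bounded vN NM cN).1).
apply: eq_bigr => i _ /=; set b := EPN _.
have Nb : N b by apply: cPN.1; apply: Pc => //; exact: Pstar.
rewrite -[lambda i (b Om)]/((lambda i \o b) Om).
have Mlb : M (lambda i \o b) by apply: Mc => //; exact: NM.
rewrite (jones_cexpM vQ QM cQ)// (jones_cexpM vN NM cN)//.
rewrite (cexp_mulr vQ cQ)//; last exact: NQ.
by rewrite (cexp_mulr vN cN)// QNl.
Qed.

Lemma commuting_sup_iff :
  e_ Q \o e_ P = e_ N <->
  p = proj_sup ip [set v \o e_ Q \o star v | v in unitaries ip P].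
Proof. by split=> [/commuting_sup ->//|]; exact: sup_commuting. Qed.

(** The bases place e_P and e_Q in the basic construction, where [tr] is a faithful trace. *)
Lemma angle_orthogonal tr : N <> P -> N <> Q ->
  (exists n (mu : 'I_n -> H -> H) EQN,
    cond_exp ip Om Q N EQN /\ pp_basis ip Q EQN mu) ->
  normalized_trace ip (basic_construction ip Om N M) tr ->
  e_ Q \o e_ P = e_ N <-> angle ip tr Om N P Q = pi / 2.
Proof.
move=> NneP NneQ [n [mu [EQN [cQN muQ]]]] trB1; have [trl _ trC trp _] := trB1.
set B1 := basic_construction ip Om N M in trB1 trl trC trp.
have bN := jones_bounded vN NM cN; have bP := jones_bounded vP PM cP.
have bQ := jones_bounded vQ QM cQ.
have algB1 : unital_algebra B1 by exact: bicommutant_algebra.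
have MB1 : M `|` [set e_ N] `<=` B1.
  by apply: bicommutant_sub => _ [/Mb//|->].
have [_ _ B1c _] := algB1.
have B1N : B1 (e_ N) by apply: MB1; right.
have B1M a : M a -> B1 a by move=> Aa; apply: MB1; left.
have B1P : B1 (e_ P).
  rewrite (jones_basis vN vP NP PM cN cP cPN lambdaP).
  apply: (algebra_sum algB1) => i; apply: (B1c _ _ _ (B1M _ (Mstar (lM i)))).
  exact: (B1c _ _ (B1M _ (lM i))).
have B1Q : B1 (e_ Q).
  rewrite (jones_basis vN vQ NQ QM cN cQ cQN muQ).
  have mM i : M (mu i) by apply: QM; exact: muQ.1.
  apply: (algebra_sum algB1) => i; apply: (B1c _ _ _ (B1M _ (Mstar (mM i)))).
  exact: (B1c _ _ (B1M _ (mM i))).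
have [NPl NPr] := jones_sub vN vP NP PM cN cP.
have [NQl NQr] := jones_sub vN vQ NQ QM cN cQ.
have QQ := jones_idem vQ QM cQ; have NNe := jones_idem vN NM cN.
have aN := jones_adjoint vN NM cN; have aP := jones_adjoint vP PM cP.
have aQ := jones_adjoint vQ QM cQ.
pose z := (e_ Q \o e_ P) - e_ N.
have B1z : B1 z by apply: algebraB => //; exact: B1c.
(* z^* z = e_P e_Q e_P - e_N, and traciality absorbs one e_P; hence tr z is nonnegative and vanishes
   only for z = 0. *)
have trz : tr (star z \o z) = tr z.
  have -> : star z = (e_ P \o e_ Q) - e_ N.
    apply: (adjP ip_norm); last by apply: adjointB => //; exact: adjoint_comp.
    rewrite addrC -scaleN1r; apply: bounded_addZ => //; exact: bounded_comp.
  have -> : ((e_ P \o e_ Q) - e_ N) \o z = (e_ P \o (e_ Q \o e_ P)) - e_ N.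
    apply/funext => x; rewrite /z /= !opDE !opNE /= (linB bQ.1) (linB bP.1) (linB bN.1).
    have /= -> := congr1 (@^~ (e_ P x)) QQ; have /= -> := congr1 (@^~ x) NQr.
    have /= -> := congr1 (@^~ x) NPr; have /= -> := congr1 (@^~ (e_ P x)) NQl.
    have /= -> := congr1 (@^~ x) NPl; have /= -> := congr1 (@^~ x) NNe.
    by rewrite subrr subr0.
  have B1QP := B1c _ _ B1Q B1P; have B1PQP := B1c _ _ B1P B1QP.
  rewrite !(traceB trB1)// trC// -compA; congr (tr (e_ Q \o _) - _).
  exact: (jones_idem vP PM cP).
have [tr_ge0 tr_eq0] := trp _ B1z.
(* The normalizing factors are genuine: e_K = e_N would give x Om = E_N(x) Om for x in K, hence K =
   N. *)
have trd K EK : von_neumann ip K -> K `<=` M -> N `<=` K -> cond_exp ip Om M K EK ->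
    N <> K -> B1 (e_ K) -> 0 < (tr_norm ip tr (e_ K - e_ N))^-1.
  move=> vK KM NK cK NneK B1K.
  have B1d : B1 (e_ K - e_ N) by exact: algebraB.
  have [d_ge0 d_eq0] := trp _ B1d.
  rewrite invr_gt0 sqrtC_gt0 lt_neqAle d_ge0 andbT eq_sym.
  apply/eqP => /d_eq0 /eqP; rewrite subr_eq0 => /eqP KN.
  apply: NneK; apply/seteqP; split=> // x Kx.
  have -> : x = EN x.
    apply: L2_ext; [exact: KM|by apply: NM; apply: cN.1; exact: KM|].
    rewrite -(jones_cexpM vN NM cN) -?KN ?(jones_fix vK KM cK)//.
    exact: KM.
  by apply: cN.1; exact: KM.
have kP := trd _ _ vP PM NP cP NneP B1P.
have kQ := trd _ _ vQ QM NQ cQ NneQ B1Q.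
have angleE : tr (star (angle_vec ip tr Om N Q) \o angle_vec ip tr Om N P) =
    (tr_norm ip tr (e_ Q - e_ N))^-1 * (tr_norm ip tr (e_ P - e_ N))^-1 * tr z.
  rewrite /angle_vec -(traceZ algB1 trB1)//.
  set k := (tr_norm _ _ _)^-1 in kQ *; set k' := (tr_norm _ _ _)^-1 in kP *.
  have -> : star (k *: (e_ Q - e_ N)) = k *: (e_ Q - e_ N).
    apply: (adjP ip_norm).
      have [Bb _ _ _] := algB1; apply: Bb; apply: (algebraZ algB1).
      exact: (algebraB algB1).
    move=> x y; rewrite !opZE ipZl ipZr conj_Creal ?gtr0_real//.
    by congr (_ * _); apply: adjointB.
  congr tr; apply/funext => x; rewrite /z /= !opZE !opDE !opNE /= (linZ bQ.1) (linZ bN.1).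
  rewrite -scalerBr scalerA; congr (_ *: _); rewrite (linB bQ.1) (linB bN.1).
  have /= -> := congr1 (@^~ x) NQr; have /= -> := congr1 (@^~ x) NPl.
  by have /= -> := congr1 (@^~ x) NNe; rewrite subrr subr0.
have zE : e_ Q \o e_ P = e_ N <-> tr z = 0.
  split=> [QP|z0].
    by rewrite /z QP subrr; exact: (trace0 algB1 trB1).
  by apply/eqP; rewrite -subr_eq0; apply/eqP/tr_eq0; rewrite trz.
rewrite zE /angle angleE; set k := _ / _.
have k0 : 0 < k by exact: mulr_gt0.
(* [angle] sees only the real part of [k * tr z]; being nonnegative, this number equals its real
   part. *)
have kz : 0 <= k * tr z by rewrite -trz; apply: mulr_ge0 => //; exact: ltW.
split=> [->|]; first by rewrite mulr0 acos0.
move=> /acos_eq_pihalf Re0; apply/eqP.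
have : k * tr z = 0 by rewrite -(RRe_real (ger0_real kz)) Re0.
by move=> /eqP; rewrite mulf_eq0 gt_eqF.
Qed.

End TwoSubfactors.

End StandardForm.

Theorem theorem3p28 (R : realType) (H : completeNormedModType R[i])
    (ip : {dot H for Num.conj}) (Om : H)
    (N M P Q : set (H -> H))
    (tr : (H -> H) -> R[i])
    (EMP EMQ EMN EPN EQN : (H -> H) -> (H -> H))
    (m n : nat) (lambda : 'I_m -> H -> H) (mu : 'I_n -> H -> H) :
  norm_from_ip ip ->
  II1_factor ip M -> is_L2 ip M Om ->
  II1_factor ip N -> N `<=` M -> finite_index ip N ->
  normalized_trace ip (basic_construction ip Om N M) tr ->
  vn_factor ip P -> N `<=` P -> P `<=` M -> P <> N ->
  vn_factor ip Q -> N `<=` Q -> Q `<=` M -> Q <> N ->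
  cond_exp ip Om M P EMP -> cond_exp ip Om M Q EMQ ->
  cond_exp ip Om M N EMN ->
  cond_exp ip Om P N EPN -> cond_exp ip Om Q N EQN ->
  pp_basis ip P EPN lambda -> pp_basis ip Q EQN mu ->
  let p := pq_op ip Om N lambda mu in
  let q := pq_op ip Om N mu lambda in
  let e_ := jones_proj ip Om in
  [/\ commuting_square M EMP EMQ EMN <-> angle ip tr Om N P Q = pi / 2,
      commuting_square M EMP EMQ EMN <->
        p = proj_sup ip [set v \o e_ Q \o adj ip v | v in unitaries ip P]
    & commuting_square M EMP EMQ EMN <->
        q = proj_sup ip [set u \o e_ P \o adj ip u | u in unitaries ip Q]].
Proof.
move=> ip_norm [[vM _] _ [trM trMP]] L2M [[vN _] _ _] NM _ trM1 [vP _] NP PM PneN.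
move=> [vQ _] NQ QM QneN cP cQ cN cPN cQN lambdaP muQ p q e_.
have Madj := trace_adjoint (von_neumann_algebra vM) trMP.
have cs := commuting_square_jones ip_norm vM L2M Madj vN vP vQ NP PM QM cN cP cQ.
(* The condition is symmetric, so the third equivalence is the second with P and Q exchanged. *)
have csC : commuting_square M EMP EMQ EMN <-> commuting_square M EMQ EMP EMN.
  by split=> h x Mx; have [h1 h2] := h x Mx.
have csC' := commuting_square_jones ip_norm vM L2M Madj vN vQ vP NQ QM PM cN cQ cP.
split.
- rewrite cs; apply: (angle_orthogonal ip_norm vM L2M Madj vN vP vQ NP NQ PM QM
    cN cP cQ cPN lambdaP _ _ _ trM1).
  + by move/esym.
  + by move/esym.
  + by exists n, mu, EQN.
- rewrite cs (commuting_sup_iff ip_norm vM L2M Madj vN vP vQ NP NQ PM QM cN cP cQ cPN lambdaP).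
  by rewrite /p (pq_opE ip_norm vM L2M Madj vN vQ NQ PM QM cN cQ lambdaP cQN muQ).
- rewrite csC csC' (commuting_sup_iff ip_norm vM L2M Madj vN vQ vP NQ NP QM PM cN cQ cP cQN muQ).
  by rewrite /q (pq_opE ip_norm vM L2M Madj vN vP NP QM PM cN cP muQ cPN lambdaP).
Qed.
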